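(* Let $T$ be a countable positive theory with the joint embedding property (JEP). Then the following are equivalent: (i) $T$ is $\omega$-categorical; (ii) every $n$-type (for every $n<\omega$) is supported; (iii) all e.c. models of $T$ are atomic; (iv) all countable e.c. models of $T$ are atomic; (v) every e.c. model of $T$ is $\omega$-saturated; (vi) there is a saturated prime e.c. model of $T$.
   Context: Positive logic: a (positive existential) formula is built from atomic formulas using $\wedge,\vee,\top,\bot,\exists$. An h-inductive sentence has the form $\forall\bar x(\varphi(\bar x)\to\psi(\bar x))$ with $\varphi,\psi$ such formulas; a (positive) theory is a set of h-inductive sentences. Theories are assumed to be consistent; a theory is countable if its signature is countable. ''Countable'' for models means of cardinality at most $\aleph_0$. A homomorphism is a function between structures preserving truth of formulas; it is an immersion if it also reflects truth of formulas. A model $M$ of $T$ is existentially closed (e.c.) if every homomorphism $f:M\to N$ with $N\models T$ is an immersion. $T^{\mathrm{ec}}$ is the set of all h-inductive sentences true in every e.c. model of $T$. JEP: for any two e.c. models $M_1,M_2$ of $T$ there are $N\models T$ and homomorphisms $M_1\to N\leftarrow M_2$. For $\bar a$ in an e.c. model $M$, $\mathrm{tp}(\bar a)$ is the set of all formulas without parameters true of $\bar a$ in $M$. An $n$-type is a set of this form with $\bar a$ an $n$-tuple in some e.c. model. A type $p(\bar x)$ in finitely many variables is supported if there is $\varphi(\bar x)\in p(\bar x)$ such that for all $\chi(\bar x)\in p(\bar x)$ we have $T^{\mathrm{ec}}\models\forall\bar x(\varphi(\bar x)\to\chi(\bar x))$. An e.c. model $M$ is atomic if it only realises supported types. It is prime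 if every e.c. model $N$ is an extension of $M$ (there is a homomorphism, necessarily an immersion, $M\to N$). It is $\kappa$-saturated if every partial type with fewer than $\kappa$ variables and fewer than $\kappa$ parameters from $M$ that is finitely satisfiable in $M$ is realised in $M$; it is saturated if it is $|M|$-saturated. $T$ is $\omega$-categorical if it has exactly one countable e.c. model up to isomorphism. *)

(* Defs.v *)
From mathcomp Require Import all_boot.
From mathcomp Require Import boolp classical_sets functions cardinality.

Set Implicit Arguments.
Unset Strict Implicit.
Unset Printing Implicit Defensive.

Local Open Scope classical_set_scope.
Local Open Scope card_scope.

Definition card_lt (S U : Type) (A : set S) (B : set U) : Prop :=
  (A #<= B) /\ ~ (B #<= A).

(* Single-sorted signatures; constants are the function symbols of arity 0. *)
Record signature : Type := Signature {
  fun_sym : Type;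
  fun_arity : fun_sym -> nat;
  rel_sym : Type;
  rel_arity : rel_sym -> nat }.

Definition countable_signature (L : signature) : Prop :=
  countable [set: fun_sym L] /\ countable [set: rel_sym L].

Inductive term (L : signature) (V : Type) : Type :=
| Var of V
| App (f : fun_sym L) of ('I_(fun_arity f) -> term L V).

(* Positive existential formulas with free variables in V. In Ex phi the
   variable None of phi is the bound one. *)
Inductive formula (L : signature) (V : Type) : Type :=
| Equal of term L V & term L V
| Rel (r : rel_sym L) of ('I_(rel_arity r) -> term L V)
| Top
| Bot
| And of formula L V & formula L V
| Or of formula L V & formula L V
| Ex of formula L (option V).

(* The domain is allowed to be empty. Nonempty domains are enforced by the
   h-inductive sentence Top -> Ex Top. *)
Record structure (L : signature) : Type := Structure {
  dom :> Type;
  fun_interp : forall f : fun_sym L, ('I_(fun_arity f) -> dom) -> dom;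
  rel_interp : forall r : rel_sym L, ('I_(rel_arity r) -> dom) -> Prop }.

Fixpoint eval (L : signature) (M : structure L) (V : Type) (e : V -> M)
    (t : term L V) : M :=
  match t with
  | Var v => e v
  | App f ts => fun_interp (fun i => eval e (ts i))
  end.

Fixpoint sat (L : signature) (M : structure L) (V : Type) (e : V -> M)
    (phi : formula L V) : Prop :=
  match phi with
  | Equal s t => eval e s = eval e t
  | Rel r ts => rel_interp (fun i => eval e (ts i))
  | Top => True
  | Bot => False
  | And p q => sat e p /\ sat e q
  | Or p q => sat e p \/ sat e q
  | Ex p => exists x : M, sat (oapp e x) p
  end.

(* HInductive phi psi is the sentence
   forall x_0 ... x_(n-1), phi(x) -> psi(x). *)
Record sentence (L : signature) : Type := HInductive {
  nvars : nat;
  premise : formula L 'I_nvars;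
  conclusion : formula L 'I_nvars }.

Definition holds (L : signature) (M : structure L) (s : sentence L) : Prop :=
  forall a : 'I_(nvars s) -> M, sat a (premise s) -> sat a (conclusion s).

Definition theory (L : signature) : Type := set (sentence L).

Definition model (L : signature) (T : theory L) (M : structure L) : Prop :=
  forall s, T s -> holds M s.

Definition entails (L : signature) (T : theory L) (s : sentence L) : Prop :=
  forall M : structure L, model T M -> holds M s.

Definition consistent (L : signature) (T : theory L) : Prop :=
  exists M : structure L, model T M.

Definition homomorphism (L : signature) (M N : structure L) (f : M -> N) :
    Prop :=
  forall (n : nat) (phi : formula L 'I_n) (a : 'I_n -> M),
    sat a phi -> sat (f \o a) phi.

Definition immersion (L : signature) (M N : structure L) (f : M -> N) : Prop :=
  homomorphism f /\
  forall (n : nat) (phi : formula L 'I_n) (a : 'I_n -> M),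
    sat (f \o a) phi -> sat a phi.

Definition isomorphic (L : signature) (M N : structure L) : Prop :=
  exists (f : M -> N) (g : N -> M),
    [/\ homomorphism f, homomorphism g, cancel f g & cancel g f].

Definition ec_model (L : signature) (T : theory L) (M : structure L) : Prop :=
  model T M /\
  forall (N : structure L) (f : M -> N),
    model T N -> homomorphism f -> immersion f.

Definition ec_theory (L : signature) (T : theory L) : theory L :=
  [set s | forall M : structure L, ec_model T M -> holds M s].

Definition JEP (L : signature) (T : theory L) : Prop :=
  forall M1 M2 : structure L, ec_model T M1 -> ec_model T M2 ->
  exists (N : structure L) (f1 : M1 -> N) (f2 : M2 -> N),
    [/\ model T N, homomorphism f1 & homomorphism f2].

Definition tp (L : signature) (M : structure L) (n : nat) (a : 'I_n -> M) :
    set (formula L 'I_n) :=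
  [set phi | sat a phi].

Definition is_type (L : signature) (T : theory L) (n : nat)
    (p : set (formula L 'I_n)) : Prop :=
  exists (M : structure L) (a : 'I_n -> M), ec_model T M /\ p = tp a.

Definition supported (L : signature) (T : theory L) (n : nat)
    (p : set (formula L 'I_n)) : Prop :=
  exists phi, p phi /\
    forall chi, p chi -> entails (ec_theory T) (HInductive phi chi).

Definition atomic (L : signature) (T : theory L) (M : structure L) : Prop :=
  forall (n : nat) (a : 'I_n -> M), supported T (tp a).

Definition prime_model (L : signature) (T : theory L) (M : structure L) :
    Prop :=
  forall N : structure L, ec_model T N -> exists f : M -> N, homomorphism f.

(* A partial type in the variables V with parameters in A is a set of formulas
   over V + A. The variable inl v is evaluated at b v, and inr a at itself. *)
Definition with_params (M V : Type) (A : set M) (b : V -> M) (x : V + A) : M :=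
  match x with inl v => b v | inr a => val a end.

Definition realises (L : signature) (M : structure L) (V : Type) (A : set M)
    (b : V -> M) (p : set (formula L (V + A))) : Prop :=
  forall phi, p phi -> sat (with_params b) phi.

Definition finitely_satisfiable (L : signature) (M : structure L) (V : Type)
    (A : set M) (p : set (formula L (V + A))) : Prop :=
  forall q : set (formula L (V + A)), q `<=` p -> finite_set q ->
    exists b : V -> M, realises b q.

(* The cardinal kappa is given as the cardinality of the type K. *)
Definition saturated_in (K : Type) (L : signature) (M : structure L) : Prop :=
  forall (V : Type) (A : set M) (p : set (formula L (V + A))),
    card_lt [set: V] [set: K] -> card_lt A [set: K] ->
    finitely_satisfiable p -> exists b : V -> M, realises b p.

Definition omega_saturated (L : signature) (M : structure L) : Prop :=
  saturated_in nat M.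

Definition saturated (L : signature) (M : structure L) : Prop :=
  saturated_in M M.

Definition omega_categorical (L : signature) (T : theory L) : Prop :=
  exists M : structure L,
    [/\ ec_model T M, countable [set: M] &
        forall N : structure L, ec_model T N -> countable [set: N] ->
          isomorphic M N].

(* Main.v *)
Require Import Defs.
From mathcomp Require Import all_boot.
From mathcomp Require Import boolp classical_sets functions cardinality filter.

(** Everything reduces to the statement that all types are supported, and that
    in turn to three tools: refutation, generic models and back-and-forth.

    Refutation ([ec_refutation]): a formula that fails at a tuple of an e.c.
    model is inconsistent, modulo T, with a formula that holds there. So the
    type of a tuple in an e.c. model is maximal ([ec_type_maximal]), and an
    inclusion between types of tuples of e.c. models is an equality. The model
    may be uncountable, so this rests on compactness in full generality, which
    is obtained from ultraproducts.

    Generic models ([generic_model]): a Henkin construction with finite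
    conditions, in which every statement about the named elements is eventually
    forced or excluded, produces a countable e.c. model. It can be asked to
    realise a given set of formulas in finitely many variables, as soon as some
    model of T does ([countable_realisation]); hence every type is realised in
    a countable e.c. model. It can also be asked to omit an unsupported type
    ([omitting_types]), since no finite condition isolates such a type.

    Thus a type that is realised in all countable e.c. models is supported. This
    yields the supportedness of all types from each of the other conditions:
    from categoricity because a countable e.c. model realising the type is
    isomorphic to all others; from atomicity of the countable models directly;
    and from saturation because a saturated e.c. model realises every type, by
    joint embedding ([saturated_realises_types]). For a saturated prime model
    the realisation is then carried into any other e.c. model.

    Conversely, let all types be supported. If tp(a) = tp(b) and the type of an
    extension (a, x) is supported by phi, then the formula obtained from phi by
    quantifying x holds at b, which gives a y such that (b, y) has the type of
    (a, x). Back-and-forth makes countable e.c. models isomorphic and embeds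
    them in all e.c. models; joint embedding starts it at the empty tuple. In
    the same way supporting formulas turn finite satisfiability into
    realisation ([supported_omega_saturated]).

    Compactness and generic models share one theorem of Łoś ([named_limit]),
    for families of structures in which a set of names denotes partially: an
    ultrafilter and all partial sections give ultraproducts, and the cofinite
    filter on an increasing sequence of conditions, with natural numbers as
    names, gives generic models. Names are partial because the domain of a
    structure may be empty. *)

Set Implicit Arguments.
Unset Strict Implicit.
Unset Printing Implicit Defensive.

Local Open Scope classical_set_scope.

(** * Renaming variables, conjunctions and quantifier blocks *)

Section Formulas.
Variable L : signature.

Fixpoint rename_term (V W : Type) (h : V -> W) (t : term L V) : term L W :=
  match t with
  | Var v => Var L (h v)
  | App f ts => @App L W f (fun i => rename_term h (ts i))
  end.

Fixpoint rename (V : Type) (phi : formula L V) (W : Type) (h : V -> W) :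
    formula L W :=
  match phi with
  | Equal s t => Equal (rename_term h s) (rename_term h t)
  | Rel r ts => @Rel L W r (fun i => rename_term h (ts i))
  | Top => Top L W
  | Bot => Bot L W
  | And p q => And (rename p h) (rename q h)
  | Or p q => Or (rename p h) (rename q h)
  | Ex p => Ex (rename p (omap h))
  end.

Lemma eval_rename (M : structure L) (V W : Type) (h : V -> W) (e : W -> M) t :
  eval e (rename_term h t) = eval (e \o h) t.
Proof. by elim: t => //= f ts IH; congr fun_interp; apply: funext. Qed.

Lemma oapp_omap (V W : Type) Y (h : V -> W) (e : W -> Y) y :
  oapp e y \o omap h = oapp (e \o h) y.
Proof. by apply: funext => -[]. Qed.

Lemma sat_rename (M : structure L) (V : Type) (phi : formula L V) (W : Type)
    (h : V -> W) (e : W -> M) :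
  sat e (rename phi h) = sat (e \o h) phi.
Proof.
elim: phi W h e => {V} //=.
- by move=> V s t W h e; rewrite !eval_rename.
- move=> V r ts W h e; congr rel_interp; apply: funext => i.
  exact: eval_rename.
- by move=> V p IHp q IHq W h e; rewrite IHp IHq.
- by move=> V p IHp q IHq W h e; rewrite IHp IHq.
- move=> V p IHp W h e; congr ex; apply: funext => x.
  by rewrite IHp oapp_omap.
Qed.

Definition big_and (V : Type) (F : finType) (phi : F -> formula L V) :
    formula L V :=
  foldr (fun i => And (phi i)) (Top L V) (enum F).

Lemma sat_big_and (V : Type) (F : finType) (phi : F -> formula L V)
    (M : structure L) (e : V -> M) :
  sat e (big_and phi) <-> forall i, sat e (phi i).
Proof.
have aux (s : seq F) : sat e (foldr (fun i => And (phi i)) (Top L V) s) <->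
    forall i, i \in s -> sat e (phi i).
  elim: s => [|j s IH] /=; first by split.
  rewrite IH; split=> [[hj hs] i|h].
    by rewrite inE => /orP[/eqP->|/hs].
  by split=> [|i si]; apply: h; rewrite inE ?eqxx // si orbT.
by rewrite aux; split=> h i => [|_]; apply: h; rewrite mem_enum.
Qed.

Lemma exists_block n (V : Type) (phi : formula L ('I_n + V)) :
  exists psi : formula L V, forall (M : structure L) (e : V -> M),
    sat e psi <->
    exists b : 'I_n -> M,
      sat (fun x => match x with inl i => b i | inr v => e v end) phi.
Proof.
elim: n V phi => [|n IH] V phi.
  pose h (x : 'I_0 + V) := match x with
    | inl i => False_rect V (notF (ltn_ord i)) | inr v => v end.
  exists (rename phi h) => M e; rewrite sat_rename.
  have b0 : 'I_0 -> M by case.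
  split=> [he|[b]].
    exists b0; congr (sat _ phi): he.
    by apply: funext => -[[]|].
  by congr (sat _ phi); apply: funext => -[[]|].
pose h (x : 'I_n.+1 + V) : 'I_n + option V := match x with
  | inl i => oapp inl (inr None) (unlift ord0 i) | inr v => inr (Some v) end.
have [psi psiP] := IH _ (rename phi h).
exists (Ex psi) => M e; split=> /=.
- move=> [x /psiP[b]]; rewrite sat_rename => hb.
  exists (fun i => oapp b x (unlift ord0 i)); congr (sat _ phi): hb.
  by apply: funext => -[i|v] //=; case: (unlift ord0 i).
- move=> [b hb]; exists (b ord0); apply/psiP.
  exists (b \o lift ord0); rewrite sat_rename; congr (sat _ phi): hb.
  by apply: funext => -[i|v] //=; case: unliftP => [j|] ->.
Qed.

End Formulas.

(** * Statements about partially named elements *)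

Section Statements.
Variable L : signature.

Record stmt (V : Type) : Type := Stmt {
  arity : nat; args : 'I_arity -> V; body : formula L 'I_arity }.
Arguments args {V} u i : rename.

Definition names (M : structure L) (V W : Type) (e : V -> option M) (g : W -> V)
    (c : W -> M) : Prop :=
  forall w, e (g w) = Some (c w).

Definition sat_at (M : structure L) (V : Type) (e : V -> option M) (u : stmt V) :
    Prop :=
  exists c, names e (args u) c /\ sat c (body u).

Lemma names_inj (M : structure L) (V W : Type) (e : V -> option M)
    (g : W -> V) c d :
  names e g c -> names e g d -> c = d.
Proof. by move=> hc hd; apply: funext => w; apply: Some_inj; rewrite -hc. Qed.

Lemma sat_atP (M : structure L) (V : Type) (e : V -> option M) n
    (g : 'I_n -> V) phi c :
  names e g c -> sat_at e (Stmt g phi) <-> sat c phi.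
Proof.
move=> gc; split=> [[d [/= gd]]|hc]; last by exists c.
by rewrite (names_inj gd gc).
Qed.

Definition stmt_and (V : Type) (u v : stmt V) : stmt V :=
  Stmt (arity := arity u + arity v)
    (fun i => match fintype.split i with
              | inl j => args u j | inr j => args v j end)
    (And (rename (body u) (@lshift _ _)) (rename (body v) (@rshift _ _))).

Lemma sat_at_and (M : structure L) (V : Type) (e : V -> option M)
    (u v : stmt V) :
  sat_at e (stmt_and u v) <-> sat_at e u /\ sat_at e v.
Proof.
split=> [[c [hc /=]]|[[c [uc hc]] [d [vd hd]]]].
  rewrite !sat_rename => -[hu hv]; split.
    exists (c \o @lshift _ _); split=> // i.
    by rewrite -hc /=; case: split_ordP => j /eqP; rewrite ?eq_shift // => /eqP->.
  exists (c \o @rshift _ _); split=> // i.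
  by rewrite -hc /=; case: split_ordP => j /eqP; rewrite ?eq_shift // => /eqP->.
exists (fun i => match fintype.split i with inl j => c j | inr j => d j end); split.
  by move=> i /=; case: (fintype.split i).
rewrite /= !sat_rename; split; [congr (sat _ _): hc | congr (sat _ _): hd];
  apply: funext => i /=;
  by case: split_ordP => j /eqP; rewrite ?eq_shift // => /eqP->.
Qed.

Lemma names_extend (M : structure L) (V W : Type) (g : W -> V) (c : W -> M) :
  (forall x y, g x = g y -> c x = c y) -> exists e, names e g c.
Proof.
move=> gc.
have [v|e he] := @choice V (option M)
    (fun v o => forall w, g w = v -> o = Some (c w)).
  have [[w0 <-]|nv] := pselect (exists w, g w = v).
    by exists (Some (c w0)) => w /gc->.
  by exists None => w gw; case: nv; exists w.
by exists e => w; apply: he.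
Qed.

(** What a statement says about a tuple of names, once the elements with the
    other names are quantified away. The equalities record coincidences of
    names, which is all that an assignment of names has to respect. *)
Lemma stmt_projection (V : Type) (u : stmt V) n (a : 'I_n -> V) :
  exists psi : formula L 'I_n, forall (M : structure L) (c : 'I_n -> M),
    sat c psi <-> exists e, names e a c /\ sat_at e u.
Proof.
pose g (x : 'I_(arity u) + 'I_n) :=
  match x with inl i => args u i | inr j => a j end.
pose same (xy : ('I_(arity u) + 'I_n) * ('I_(arity u) + 'I_n)) :=
  if pselect (g xy.1 = g xy.2) then Equal (Var L xy.1) (Var L xy.2)
  else Top L _.
have [psi psiP] := exists_block (And (rename (body u) inl) (big_and same)).
exists psi => M c; rewrite psiP /=; split.
- move=> [b [hb /sat_big_and hs]].
  set d := (X in sat X (rename _ _)) in hb hs.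
  have [|e he] := @names_extend M V _ g d.
    move=> x y gxy; have := hs (x, y); rewrite /same /=.
    by case: pselect.
  exists e; split; first by move=> j; exact: (he (inr j)).
  exists b; split; first by move=> i; exact: (he (inl i)).
  by rewrite sat_rename in hb.
- move=> [e [ec [b [eb hb]]]]; exists b; rewrite sat_rename; split=> //.
  apply/sat_big_and => -[x y]; rewrite /same /=.
  case: pselect => //= gxy; apply: Some_inj.
  have eg z : e (g z) =
      Some (match z with inl i => b i | inr v => c v end).
    by case: z => i; [exact: eb | exact: ec].
  by rewrite -!eg gxy.
Qed.

End Statements.
Arguments args {L V} u i : rename.

(** * Limits of structures along a filter *)

(** The quotient consists of chosen representatives instead of classes, and so
    stays in the universe of X. *)
Lemma quotient_exists (X : Type) (R : X -> X -> Prop) :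
  (forall x, R x x) -> (forall x y, R x y -> R y x) ->
  (forall x y z, R x y -> R y z -> R x z) ->
  exists (Q : Type) (pi : X -> Q) (repr : Q -> X),
    cancel repr pi /\ forall x y, pi x = pi y <-> R x y.
Proof.
move=> Rr Rs Rt.
pose canon x := sval (cid (ex_intro (R x) x (Rr x))).
have canonR x : R x (canon x) by exact: svalP (cid _).
have canonE x y : canon x = canon y <-> R x y.
  split=> [xy|xy]; first by apply: Rt (canonR x) _; rewrite xy; exact/Rs.
  rewrite /canon; move: (ex_intro _ _ _) (ex_intro (R y) _ _).
  have -> : R x = R y.
    by apply: funext => z; apply: propext; split; apply: Rt => //; exact: Rs.
  by move=> p q; rewrite (Prop_irrelevance p q).
have canonK x : canon (canon x) = canon x by apply/canonE/Rs.
exists {x | canon x = x}.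
exists (fun x => exist (fun x => canon x = x) (canon x) (canonK x)), sval.
split=> [[x xK]|x y]; first by apply: eq_exist.
rewrite -canonE; split=> [[] //|xy]; exact: eq_exist.
Qed.

Definition cons_args X n (x : X) (g : 'I_n -> X) : 'I_n.+1 -> X :=
  fun i => oapp g x (unlift ord0 i).

(** The numbering of the variables of a quantified formula for which
    [cons_args] is the extended assignment. *)
Definition unoption n : option 'I_n -> 'I_n.+1 := oapp (lift ord0) ord0.

Lemma cons_args_unoption X n (x : X) (g : 'I_n -> X) :
  cons_args x g \o @unoption n = oapp g x.
Proof.
by apply: funext => -[i|]; rewrite /cons_args /= ?liftK // unlift_none.
Qed.

Section Limit.
Variables (L : signature) (I : Type) (N : I -> structure L) (F : set_system I).
Hypothesis FF : ProperFilter F.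
Variables (X : Type) (val : forall i, X -> option (N i)).

Hypothesis defined : forall x, F [set i | exists y, val i x = Some y].
Hypothesis decided : forall u : stmt L X,
  F [set i | sat_at (val i) u] \/ F [set i | ~ sat_at (val i) u].
Hypothesis witnessed : forall n (g : 'I_n -> X) phi,
  F [set i | sat_at (val i) (Stmt g (Ex phi))] ->
  exists x, F [set i |
    sat_at (val i) (Stmt (cons_args x g) (rename phi (@unoption n)))].

Let named n (g : 'I_n -> X) : F [set i | exists c, names (val i) g c].
Proof.
apply: filterS (filter_forall _ (fun j : 'I_n => defined (g j))).
by move=> i /choice[c cP]; exists c.
Qed.

Let same x y := F [set i | exists z, val i x = Some z /\ val i y = Some z].

Let same_refl x : same x x.
Proof. by apply: filterS (defined x) => i [y iy]; exists y. Qed.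

Let same_sym x y : same x y -> same y x.
Proof. by apply: filterS => i [z [? ?]]; exists z. Qed.

Let same_trans x y z : same x y -> same y z -> same x z.
Proof.
move=> xy yz; apply: filterS2 xy yz => i [a [xa ya]] [b [yb zb]].
by exists a; rewrite xa zb -yb ya.
Qed.

Let fun_value (f : fun_sym L) (xs : 'I_(fun_arity f) -> X) :
  exists y, F [set i | exists2 c, names (val i) xs c &
                                  val i y = Some (fun_interp c)].
Proof.
have [|y yP] := @witnessed _ xs
    (Equal (Var L None) (@App L _ f (fun j => Var L (Some j)))).
  apply: filterS (named xs) => i [c xsc]; exists c; split=> //=.
  by exists (fun_interp c).
exists y; apply: filterS yP => i [c [xyc]]; rewrite sat_rename => /= yc.
have cE j : val i (xs j) = Some (c (lift ord0 j)).
  by rewrite -xyc /cons_args /= liftK.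
exists (c \o lift ord0) => //.
by have := xyc ord0; rewrite /= /cons_args unlift_none /= => ->; rewrite yc.
Qed.

(** The theorem of Łoś for a proper filter and a set X of partial sections of
    the family. The hypotheses [decided] and [witnessed] are what the inductive
    steps for disjunctions and for quantifiers need; an ultrafilter and the
    set of all partial sections satisfy both. *)
Lemma filter_limit :
  exists (M : structure L) (pi : X -> M) (repr : M -> X), cancel repr pi /\
    forall u : stmt L X,
      sat (pi \o args u) (body u) <-> F [set i | sat_at (val i) u].
Proof.
have [Q [pi [repr [reprK piE]]]] :=
  quotient_exists same_refl same_sym same_trans.
pose fi (f : fun_sym L) (qs : 'I_(fun_arity f) -> Q) :=
  pi (sval (cid (fun_value (repr \o qs)))).
pose ri (r : rel_sym L) (qs : 'I_(rel_arity r) -> Q) :=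
  F [set i | sat_at (val i) (Stmt (repr \o qs) (@Rel L _ r (fun j => Var L j)))].
pose M := Structure fi ri.
exists M, pi, repr; split=> //.
have limit_eval V (t : term L V) n (h : V -> 'I_n) (g : 'I_n -> X) x :
    @eval L M V (pi \o g \o h) t = pi x ->
    F [set i | exists2 c, names (val i) g c & val i x = Some (eval (c \o h) t)].
  elim: t x => [v|f ts IH] x /=.
    move/piE => gx; apply: filterS2 (named g) gx => i [c gc] [z [gz xz]].
    by exists c => //=; rewrite xz -gz gc.
  rewrite /fi /=; case: cid => y /= yP /piE yx.
  have IHr j := IH j (repr (@eval L M V (pi \o g \o h) (ts j))) (esym (reprK _)).
  apply: filterS3 (filterI (named g) (filter_forall _ IHr)) yP yx.
  move=> i [[c gc] ic] [d qd yd] [z [yz xz]]; exists c => //.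
  rewrite xz -yz yd; congr Some; congr fun_interp; apply: funext => j.
  have [c' gc'] := ic j; rewrite (names_inj gc' gc) => jE.
  by apply: Some_inj; rewrite -jE -qd.
suff limit_sat V (phi : formula L V) n (h : V -> 'I_n) (g : 'I_n -> X) :
    @sat L M V (pi \o g \o h) phi <->
    F [set i | exists2 c, names (val i) g c & sat (c \o h) phi].
  move=> [n g phi]; have := limit_sat _ phi n id g => /= ->.
  split; apply: filterS => i [c]; first by move=> gc hc; exists c.
  by move=> [gc hc]; exists c.
elim: phi n h g => {V} /=.
- move=> V s t n h g.
  have sP := limit_eval V s n h g _ (esym (reprK _)).
  have tP := limit_eval V t n h g _ (esym (reprK _)).
  split=> [st|st].
    rewrite st in sP; apply: filterS2 sP tP => i [c gc sc] [d gd td].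
    exists c => //; apply: Some_inj; rewrite -sc td.
    by rewrite (names_inj gd gc).
  rewrite -[LHS]reprK -[RHS]reprK; apply/piE.
  apply: filterS3 st sP tP => i [c gc st] [d gd sd] [e ge te].
  exists (eval (c \o h) s).
  by rewrite sd te (names_inj gd gc) (names_inj ge gc) st.
- move=> V r ts n h g.
  have tP j := limit_eval V (ts j) n h g _ (esym (reprK _)).
  split; rewrite /ri /=.
    move=> rP; apply: filterS3 (named g) rP (filter_forall _ tP).
    move=> i [c gc] [d [qd /= rd]] ic; exists c => //.
    congr rel_interp: rd; apply: funext => j.
    have [c' gc'] := ic j; rewrite (names_inj gc' gc) => jE.
    by apply: Some_inj; rewrite -jE -qd.
  move=> rP; apply: filterS2 rP (filter_forall _ tP) => i [c gc rc] ic.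
  exists (fun j => eval (c \o h) (ts j)); split=> // j /=.
  by have [c' gc'] := ic j; rewrite (names_inj gc' gc) => ->.
- move=> V n h g; split=> // _; apply: filterS (named g) => i [c gc].
  by exists c.
- move=> V n h g; split=> // F0; apply: (@filter_not_empty _ F FF).
  by apply: filterS F0 => i [].
- move=> V p IHp q IHq n h g; rewrite IHp IHq; split.
    move=> [pP qP]; apply: filterS2 pP qP => i [c gc pc] [d gd qd].
    by exists c => //; split=> //; rewrite (names_inj gc gd).
  by move=> pq; split; apply: filterS pq => i [c gc []]; exists c.
- move=> V p IHp q IHq n h g; rewrite IHp IHq; split.
    by move=> -[]; apply: filterS => i [c gc ?]; exists c => //; [left|right].
  move=> pq; have [pP|npP] := decided (Stmt g (rename p h)).
    left; apply: filterS pP => i [c [gc]]; rewrite sat_rename => pc.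
    by exists c.
  right; apply: filterS2 pq npP => i [c gc [pc|qc]] np; last by exists c.
  by case: np; exists c; rewrite sat_rename.
- move=> V p IHp n h g.
  pose h' := @unoption n \o omap h.
  have hE Y (y : Y) (c : 'I_n -> Y) : cons_args y c \o h' = oapp (c \o h) y.
    by rewrite -oapp_omap -(cons_args_unoption y c).
  have piE' x : oapp (pi \o g \o h) (pi x) = pi \o cons_args x g \o h'.
    rewrite -hE; apply: funext => v; rewrite /= /cons_args.
    by case: (unlift _ _).
  split=> [[q]|pP].
    rewrite -[q]reprK piE' => /IHp; apply: filterS => i [c gc pc].
    exists (c \o lift ord0).
      by move=> j; rewrite -gc /cons_args /= liftK.
    exists (c ord0); congr (sat _ p): pc.
    rewrite -hE; apply: funext => v; rewrite /= /cons_args.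
    by case: unliftP => [j|] ->.
  have [|x xP] := @witnessed n g (rename p (omap h)).
    apply: filterS pP => i [c gc [y py]]; exists c; split=> //=; exists y.
    by rewrite sat_rename oapp_omap.
  exists (pi x); rewrite piE'; apply/IHp; apply: filterS xP => i [c [gc]].
  by rewrite !sat_rename => pc; exists c.
Qed.

Lemma filter_limit_model T (M : structure L) (pi : X -> M) (repr : M -> X) :
  cancel repr pi ->
  (forall u : stmt L X,
     sat (pi \o args u) (body u) <-> F [set i | sat_at (val i) u]) ->
  F [set i | model T (N i)] -> model T M.
Proof.
move=> reprK limitP NT s Ts a.
have -> : a = pi \o (repr \o a) by apply: funext => j; rewrite /= reprK.
move=> /(limitP (Stmt _ _)) hp; apply/(limitP (Stmt _ _)).
apply: filterS2 NT hp => i iT [c [ac pc]].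
by exists c; split=> //; apply: iT Ts _ pc.
Qed.

End Limit.

Section NamedLimit.
Variables (L : signature) (I : Type) (N : I -> structure L) (F : set_system I).
Hypothesis FF : ProperFilter F.
Variables (V : Type) (e : forall i, V -> option (N i)).

Hypothesis decided : forall u : stmt L V,
  F [set i | sat_at (e i) u] \/ F [set i | ~ sat_at (e i) u].
Hypothesis witnessed : forall n (g : 'I_n -> V) phi,
  F [set i | sat_at (e i) (Stmt g (Ex phi))] ->
  exists v, F [set i |
    sat_at (e i) (Stmt (cons_args v g) (rename phi (@unoption n)))].

(** Names that fail to denote almost everywhere denote nothing in the limit. *)
Lemma named_limit :
  exists (M : structure L) (name : V -> option M),
    [/\ forall m, exists v, name v = Some m,
        forall u, sat_at name u <-> F [set i | sat_at (e i) u] &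
        forall T, F [set i | model T (N i)] -> model T M].
Proof.
pose D v := F [set i | exists y, e i v = Some y].
pose X := {v | D v}; pose val i (x : X) := e i (sval x).
have [||| M [pi [repr [reprK limitP]]]] := @filter_limit L I N F FF X val.
- by move=> [].
- by move=> u; exact: (decided (Stmt (sval \o args u) (body u))).
- move=> n g phi exP; have [v vP] := @witnessed n (sval \o g) phi exP.
  have Dv : D v.
    apply: filterS vP => i [c [vc _]]; exists (c ord0).
    by rewrite -vc /= /cons_args unlift_none.
  exists (exist _ v Dv); apply: filterS vP => i [c [vc pc]]; exists c.
  by split=> // j; rewrite -vc /= /val /cons_args; case: (unlift _ _).
pose name v : option M := match pselect (D v) with
  | left Dv => Some (pi (exist _ v Dv)) | right _ => None end.
have nameE (x : X) : name (sval x) = Some (pi x).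
  case: x => v Dx; rewrite /name /=; case: pselect => [Dv|/(_ Dx) //].
  by congr (Some (pi _)); apply: eq_exist.
exists M, name; split.
- by move=> m; exists (sval (repr m)); rewrite nameE reprK.
- move=> u; split=> [[c [uc pc]]|uF].
    have Du j : D (args u j).
      by have := uc j; rewrite /name; case: pselect.
    pose g j : X := exist _ _ (Du j).
    apply/(limitP (Stmt g (body u))); congr (sat _ _): pc.
    by apply: funext => j; apply: Some_inj; rewrite -uc -nameE.
  have Du j : D (args u j).
    by apply: filterS uF => i [c [ec _]]; exists (c j); rewrite ec.
  pose g j : X := exist _ _ (Du j).
  exists (pi \o g); split; first by move=> j; rewrite -nameE.
  exact/(limitP (Stmt g (body u))).
- move=> T NT; exact: filter_limit_model reprK limitP NT.
Qed.

End NamedLimit.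

(** * Compactness and existentially closed models *)

Section Compactness.
Variables (L : signature) (T : theory L).

(** In the ultraproduct over the statements of Gamma the names are all partial
    sections, so that a witness may exist in some factors only. *)
Lemma compactness (V : Type) (Gamma : set (stmt L V)) :
  (exists u, Gamma u) ->
  (forall u v, Gamma u -> Gamma v -> Gamma (stmt_and u v)) ->
  (forall u, Gamma u ->
     exists (N : structure L) (e : V -> option N), model T N /\ sat_at e u) ->
  exists (N : structure L) (e : V -> option N),
    model T N /\ forall u, Gamma u -> sat_at e u.
Proof.
move=> [u0 Gu0] Gand Gsat.
pose I := {u | Gamma u}.
have [|Ne NeP] := @choice I {N : structure L & V -> option N}
    (fun i Ne => model T (projT1 Ne) /\ sat_at (projT2 Ne) (sval i)).
  move=> [u /= Gu]; have [N [e eP]] := Gsat u Gu.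
  by exists (existT (fun N : structure L => V -> option N) N e).
pose N i := projT1 (Ne i); pose e i : V -> option (N i) := projT2 (Ne i).
pose B (i : I) := [set j : I | sat_at (e j) (sval i)].
have F0 : ProperFilter (filter_from setT B).
  apply: filter_from_proper.
    apply: filter_from_filter; first by exists (exist _ u0 Gu0).
    move=> [u Gu] [v Gv] _ _; exists (exist _ _ (Gand _ _ Gu Gv)) => // i.
    by rewrite /B /= => /sat_at_and.
  by move=> i _; exists i; have [] := NeP i.
have [U [UU F0U]] := ultraFilterLemma F0.
have UF : ProperFilter U by exact: ultra_proper.
have [|| M [name [_ limitP MT]]] :=
    @named_limit L I N U UF (forall i, option (N i)) (fun i x => x i).
- by move=> u; exact: in_ultra_setVsetC.
- move=> n g phi exP.
  have opt i : exists o : option (N i),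
      sat_at (@^~ i) (Stmt g (Ex phi)) -> exists y c,
        [/\ o = Some y, names (@^~ i) g c & sat (oapp c y) phi].
    have [[c [gc [y yP]]]|h] := pselect (sat_at (@^~ i) (Stmt g (Ex phi))).
      by exists (Some y) => _; exists y, c.
    by exists None => /h.
  exists (fun i => sval (cid (opt i))); apply: filterS exP => i ei.
  have [y [c [xy gc yc]]] := svalP (cid (opt i)) ei.
  exists (cons_args y c); split.
    by move=> j; rewrite /= /cons_args; case: (unlift _ _).
  by rewrite sat_rename cons_args_unoption.
exists M, (fun v => name (e^~ v)); split.
  by apply: MT; apply: filterS filterT => i _; have [] := NeP i.
move=> u Gu; apply/(limitP (Stmt (fun j => e^~ (args u j)) (body u))).
by apply: F0U; exists (exist _ u Gu).
Qed.

(** In an e.c. model a formula that fails is refuted by a formula that holds: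
    otherwise the positive diagram of the model would be consistent with it, and
    a model of T satisfying both would receive a homomorphism that is not an
    immersion. *)
Lemma ec_refutation (M : structure L) n (a : 'I_n -> M) phi :
  ec_model T M -> ~ sat a phi ->
  exists psi, sat a psi /\ forall (N : structure L) (c : 'I_n -> N),
    model T N -> sat c psi -> ~ sat c phi.
Proof.
move=> [MT Mec] nphi; apply: contrapT => nopsi.
pose Gamma := [set u : stmt L M | exists w, sat_at (@Some M) w /\
  forall (N : structure L) (e : M -> option N),
    sat_at e w -> sat_at e (Stmt a phi) -> sat_at e u].
have diagram u : sat_at (@Some M) u -> Gamma u by exists u.
have [|||N [e [NT eP]]] := @compactness M Gamma.
- exists (Stmt a (Top L _)); apply: diagram.
  by exists a.
- move=> u v [w [wM wu]] [w' [wM' wv]]; exists (stmt_and w w').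
  rewrite sat_at_and; split=> // N e; rewrite !sat_at_and => -[ew ew'] ea.
  by split; [exact: wu | exact: wv].
- move=> u [w [wM wu]]; have [psi psiP] := stmt_projection w a.
  apply: contrapT => noe; apply: nopsi; exists psi; split.
    by apply/psiP; exists (@Some M).
  move=> N c NT /psiP[e [ac ew]] pc; apply: noe; exists N, e; split=> //.
  by apply: wu => //; exists c.
have [|f fP] := @choice M N (fun m y => e m = Some y).
  move=> m; have [|c [mc _]] := eP (Stmt (fun _ : 'I_1 => m) (Top L _)).
    by apply: diagram; exists (fun _ => m).
  by exists (c ord0); rewrite -(mc ord0).
have fhom : homomorphism f.
  move=> k chi b hb; have eb : names e b (f \o b) by move=> j; exact: fP.
  by apply/(sat_atP _ eb)/eP/diagram; exists b.
have [_ fimm] := Mec N f NT fhom; apply: nphi; apply: fimm.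
have ea : names e a (f \o a) by move=> j; exact: fP.
apply/(sat_atP _ ea)/eP; exists (Stmt a (Top L _)); split=> //.
by exists a.
Qed.

(** A formula outside tp(a) is refuted by a formula in tp(a), hence in tp(b). *)
Lemma ec_type_maximal (M N : structure L) n (a : 'I_n -> M) (b : 'I_n -> N) :
  ec_model T M -> model T N -> tp a `<=` tp b -> tp a = tp b.
Proof.
move=> Mec NT ab; apply/seteqP; split=> // phi pb; apply: contrapT => na.
by have [psi [/ab psib /(_ _ _ NT psib)]] := ec_refutation Mec na.
Qed.

Lemma ec_theory_entails s :
  entails (ec_theory T) s <-> forall M : structure L, ec_model T M -> holds M s.
Proof.
split=> [sP M Mec|sP M]; last exact.
by apply: sP => s'; apply.
Qed.

End Compactness.

(** * Countably many statements *)

Section Encoding.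
Variables (L : signature) (fcode : fun_sym L -> nat) (rcode : rel_sym L -> nat).
Hypotheses (fcode_inj : injective fcode) (rcode_inj : injective rcode).

Fixpoint encode_term (V : Type) (c : V -> nat) (t : term L V) :
    GenTree.tree nat :=
  match t with
  | Var v => GenTree.Leaf (c v)
  | App f ts => GenTree.Node (fcode f)
      [seq encode_term c (ts i) | i <- enum 'I_(fun_arity f)]
  end.

Fixpoint encode (V : Type) (phi : formula L V) (c : V -> nat) :
    GenTree.tree nat :=
  match phi with
  | Equal s t => GenTree.Node 0 [:: encode_term c s; encode_term c t]
  | Rel r ts => GenTree.Node 1 (GenTree.Leaf (rcode r) ::
      [seq encode_term c (ts i) | i <- enum 'I_(rel_arity r)])
  | Top => GenTree.Node 2 [::]
  | Bot => GenTree.Node 3 [::]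
  | And p q => GenTree.Node 4 [:: encode p c; encode q c]
  | Or p q => GenTree.Node 5 [:: encode p c; encode q c]
  | Ex p => GenTree.Node 6 [:: encode p (oapp (S \o c) 0)]
  end.

Lemma map_enum_inj n (T : Type) (f g : 'I_n -> T) :
  [seq f i | i <- enum 'I_n] = [seq g i | i <- enum 'I_n] -> f =1 g.
Proof.
by move=> /eq_in_map fg i; apply: fg; rewrite mem_enum.
Qed.

Lemma map_enum_size n m (T : Type) (f : 'I_n -> T) (g : 'I_m -> T) :
  [seq f i | i <- enum 'I_n] = [seq g i | i <- enum 'I_m] -> n = m.
Proof. by move/(congr1 size); rewrite !size_map -!enumT !size_enum_ord. Qed.

Lemma encode_term_inj (V : Type) (c : V -> nat) :
  injective c -> injective (encode_term c).
Proof.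
move=> c_inj; elim=> [v|f ts IH] [w|h us] //= [].
  by move=> /c_inj->.
move=> /fcode_inj fh; case: _ / fh us => us /map_enum_inj tu.
by congr App; apply: funext => i; apply: IH.
Qed.

Lemma encode_inj (V : Type) (c : V -> nat) :
  injective c -> injective (fun phi => encode phi c).
Proof.
move=> c_inj phi; elim: phi c c_inj => {V}.
- move=> V s t c c_inj [] //= s' t' [].
  by move=> /(encode_term_inj c_inj)-> /(encode_term_inj c_inj)->.
- move=> V r ts c c_inj [] //= r' ts' [/rcode_inj rr'].
  case: _ / rr' ts' => us /map_enum_inj tu.
  by congr Rel; apply: funext => i; apply: (encode_term_inj c_inj).
- by move=> V c c_inj [].
- by move=> V c c_inj [].
- move=> V p IHp q IHq c c_inj [] //= p' q' [].
  by move=> /(IHp _ c_inj)-> /(IHq _ c_inj)->.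
- move=> V p IHp q IHq c c_inj [] //= p' q' [].
  by move=> /(IHp _ c_inj)-> /(IHq _ c_inj)->.
- move=> V p IHp c c_inj [] //= p' [] /IHp-> //.
  by move=> [x|] [y|] //= [/c_inj->].
Qed.

End Encoding.

Lemma countable_stmt (L : signature) :
  countable_signature L -> exists code : stmt L nat -> nat, injective code.
Proof.
move=> [/countable_injP[f f_inj] /countable_injP[r r_inj]].
have {}f_inj : injective f by move=> x y; apply: f_inj; rewrite inE.
have {}r_inj : injective r by move=> x y; apply: r_inj; rewrite inE.
exists (fun u => pickle ([seq args u i | i <- enum 'I_(arity u)],
                         encode f r (body u) (@nat_of_ord _))).
move=> [n g phi] [m h psi] /= /(pcan_inj pickleK) /= [gh].
have nm : n = m by exact: map_enum_size gh.
case: _ / nm h psi gh => h psi /map_enum_inj/funext->.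
by move=> /(encode_inj f_inj r_inj (@ord_inj _))->.
Qed.

(** * Generic models *)

(** The Rasiowa-Sikorski lemma. Generic models and back-and-forth are both
    obtained from it, with different conditions. *)
Lemma generic_sequence (P J : Type) (ok : P -> Prop) (le : P -> P -> Prop)
    (D : J -> P -> Prop) (code : J -> nat) (p0 : P) :
  injective code -> (forall p, le p p) ->
  (forall p q r, le p q -> le q r -> le p r) ->
  (forall j p, ok p -> exists q, [/\ ok q, le p q & D j q]) -> ok p0 ->
  exists s : nat -> P, [/\ s 0 = p0, forall k, ok (s k),
    forall k l, k <= l -> le (s k) (s l) & forall j, exists k, D j (s k)].
Proof.
move=> code_inj le_refl le_trans dense ok0.
have [|step stepP] := @choice (nat * P) P (fun kp q => ok kp.2 ->
    [/\ ok q, le kp.2 q & forall j, code j = kp.1 -> D j q]).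
  move=> [k p] /=; have [okp|nokp] := pselect (ok p); last by exists p.
  have [[j jk]|noj] := pselect (exists j, code j = k).
    have [q [okq pq Dq]] := dense j p okp; exists q => _; split=> // i ik.
    by rewrite (code_inj i j) // ik.
  by exists p => _; split=> // j jk; case: noj; exists j.
pose s := fix s k := if k is l.+1 then step (l, s l) else p0.
have oks k : ok (s k) by elim: k => //= k /(stepP (k, _))[].
exists s; split=> //.
  move=> k l; elim: l => [|l IH]; first by rewrite leqn0 => /eqP->.
  rewrite leq_eqVlt => /orP[/eqP->//|/IH kl].
  by apply: le_trans kl _; have [] := stepP (l, s l) (oks l).
move=> j; exists (code j).+1 => /=.
by have [_ _] := stepP (code j, s (code j)) (oks _); apply.
Qed.

Section GenericModel.
Variables (L : signature) (T : theory L).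
Hypothesis countL : countable_signature L.
Variables (n : nat) (Sigma : set (formula L 'I_n)).

(** The structures over which conditions are tested: natural numbers serve as
    names, and the first n of them are reserved for a realisation of Sigma. *)
Definition pointed_model (N : structure L) (e : nat -> option N) : Prop :=
  model T N /\ exists c, names e (@nat_of_ord n) c /\ Sigma `<=` tp c.

Definition condition (u : stmt L nat) : Prop :=
  exists (N : structure L) (e : nat -> option N),
    pointed_model e /\ sat_at e u.

Definition forces (u v : stmt L nat) : Prop :=
  forall (N : structure L) (e : nat -> option N),
    pointed_model e -> sat_at e u -> sat_at e v.

Lemma forces_andr u v : forces (stmt_and u v) v.
Proof. by move=> N e _ /sat_at_and[]. Qed.

Lemma sat_at_update (N : structure L) (e : nat -> option N) (u : stmt L nat) k
    o :
  (forall j, args u j < k) ->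
  sat_at e u -> sat_at (fun i => if i == k then o else e i) u.
Proof.
move=> uk [c [uc hc]]; exists c; split=> // j.
by rewrite -uc ltn_eqF.
Qed.

Lemma args_bounded (u : stmt L nat) : exists k, forall j, args u j < k.
Proof.
exists (\max_j args u j).+1 => j; rewrite ltnS.
exact: (leq_bigmax (F := fun j => args u j)).
Qed.

Definition instance (i : nat) (u : stmt L nat) : stmt L nat :=
  match body u with
  | Ex phi => Stmt (cons_args i (args u)) (rename phi (@unoption (arity u)))
  | _ => u
  end.

(** A condition that allows an existential statement can be strengthened by
    giving a fresh name to a witness. *)
Lemma condition_instance u v : condition (stmt_and u v) ->
  exists i, condition (stmt_and (stmt_and u v) (instance i v)).
Proof.
move=> [N [e [[NT [c [ec cS]]] /sat_at_and[eu ev]]]].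
have trivial_case : (forall i, instance i v = v) ->
    exists i, condition (stmt_and (stmt_and u v) (instance i v)).
  move=> vE; exists 0, N, e; rewrite vE !sat_at_and; split=> //.
  by split=> //; exists c.
have [ku kuP] := args_bounded u; have [kv kvP] := args_bounded v.
case: v ev kvP trivial_case => m g [s t|r ts|||p q|p q|phi] ev kvP triv;
  try exact: triv.
clear triv.
(* a name outside Sigma, u and v *)
pose i := maxn n (maxn ku kv); exists i.
have [d [gd [y yP]]] := ev.
exists N, (fun l => if l == i then Some y else e l); split.
  split=> //; exists c; split=> // j.
  by rewrite -ec ltn_eqF // (leq_trans (ltn_ord j)) // leq_maxl.
rewrite !sat_at_and; split; first split.
- apply: sat_at_update eu => j; rewrite (leq_trans (kuP j)) //.
  by rewrite /i maxnCA leq_maxl.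
- apply: sat_at_update ev => j; rewrite (leq_trans (kvP j)) //.
  by rewrite /i maxnA leq_maxr.
exists (cons_args y d); split; last by rewrite sat_rename cons_args_unoption.
move=> j; rewrite /= /cons_args; case: (unlift _ _) => [l|] /=.
  rewrite -gd ltn_eqF // (leq_trans (kvP l)) //.
  by rewrite /i maxnA leq_maxr.
by rewrite eqxx.
Qed.

Definition settles (u w : stmt L nat) : Prop :=
  ~ condition (stmt_and w u) \/
  forces w u /\ exists i, forces w (instance i u).

Lemma settles_dense u w : condition w ->
  exists v, [/\ condition v, forces v w & settles u v].
Proof.
move=> okw; have [wu|nwu] := pselect (condition (stmt_and w u)); last first.
  by exists w; split=> //; left.
have [i wi] := condition_instance wu.
exists (stmt_and (stmt_and w u) (instance i u)); split=> //.
  by move=> N e _; rewrite !sat_at_and => -[[]].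
right; split; first by move=> N e _; rewrite !sat_at_and => -[[]].
by exists i; exact: forces_andr.
Qed.

Lemma sat_at_homomorphism (M N : structure L) (f : M -> N) (V : Type)
    (e : V -> option M) u :
  homomorphism f -> sat_at e u -> sat_at (omap f \o e) u.
Proof.
move=> fhom [c [uc hc]]; exists (f \o c); split; last exact: fhom.
by move=> j; rewrite /= uc.
Qed.

(** A Henkin construction with finite conditions. Deciding every statement
    makes the limit a model of T; since a statement that fails in it is
    refuted by a condition true in it, the limit is moreover e.c. *)
Lemma generic_model (J : Type) (code : J -> nat) (D : J -> stmt L nat -> Prop) :
  injective code ->
  (forall j u, condition u ->
     exists v, [/\ condition v, forces v u & D j v]) ->
  (exists (N : structure L) (c : 'I_n -> N), model T N /\ Sigma `<=` tp c) ->
  exists (M : structure L) (e : nat -> option M),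
    [/\ ec_model T M, pointed_model e, forall m, exists i, e i = Some m &
        forall j, exists v, D j v /\ sat_at e v].
Proof.
move=> code_inj Ddense [N0 [c0 [N0T c0S]]].
have [code' code'_inj] := countable_stmt countL.
pose D' (x : stmt L nat + J) := match x with
  inl u => settles u | inr j => D j end.
pose code'' (x : stmt L nat + J) := pickle (match x with
  inl u => inl (code' u) | inr j => inr (code j) end : nat + nat).
pose u0 := Stmt (@nat_of_ord n) (Top L _).
have [|||||s [_ oks les Ds]] := @generic_sequence _ _ condition
    (fun u v => forces v u) D' code'' u0.
- move=> [x|x] [y|y] /(pcan_inj pickleK) //= []; first by move/code'_inj->.
  by move/code_inj->.
- by move=> u N e.
- by move=> u v w uv vw N e eP ew; apply/uv/vw.
- by move=> [u|j] w; [exact: settles_dense | exact: Ddense].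
- have [e ec] : exists e : nat -> option N0, names e (@nat_of_ord n) c0.
    by apply: names_extend => x y /ord_inj->.
  by exists N0, e; split; [split=> //; exists c0|exists c0].
have [|Ne NeP] := @choice nat {N : structure L & nat -> option N}
    (fun k Ne => pointed_model (projT2 Ne) /\ sat_at (projT2 Ne) (s k)).
  move=> k; have [N [f fP]] := oks k.
  by exists (existT (fun N : structure L => nat -> option N) N f).
pose e k : nat -> option (projT1 (Ne k)) := projT2 (Ne k).
have eP k : pointed_model (e k) by have [] := NeP k.
have es k l : k <= l -> sat_at (e l) (s k).
  by move=> kl; have [pl sl] := NeP l; exact: les kl _ _ pl sl.
pose F : set_system nat := \oo.
have FF : ProperFilter F by exact: eventually_filter.
have refuteF k u :
    ~ condition (stmt_and (s k) u) -> F [set l | ~ sat_at (e l) u].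
  move=> nu; exists k => // l kl lu; apply: nu.
  exists (projT1 (Ne l)), (e l); split=> //.
  by apply/sat_at_and; split=> //; exact: es.
have forceF k u : forces (s k) u -> F [set l | sat_at (e l) u].
  by move=> fu; exists k => // l kl; apply: fu => //; exact: es.
have [||M [name [nameS limitP MT]]] :=
    @named_limit L nat (fun k => projT1 (Ne k)) F FF nat e.
- move=> u; have [k [/refuteF|[/forceF fu _]]] := Ds (inl u); first by right.
  by left.
- move=> m g phi exP; have [k [/refuteF nP|[_ [i /forceF fi]]]] :=
    Ds (inl (Stmt g (Ex phi))).
    by case: (@filter_not_empty _ F FF); apply: filterS2 exP nP => l ? [].
  by exists i.
have FP (P : set nat) : (forall k, P k) -> F P by move=> hP; exists 0.
have sM k : sat_at name (s k) by apply/limitP; exists k => // l; exact: es.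
have {}MT : model T M by apply: MT; apply: FP => k; have [] := eP k.
have nameP : pointed_model name.
  split=> //; have [|c [nc _]] := (limitP u0).2.
    by apply: FP => k; have [_ [c [pc _]]] := eP k; exists c.
  exists c; split=> // phi Sphi; apply/(sat_atP phi nc)/limitP.
  apply: FP => k; have [_ [d [pd dS]]] := eP k.
  by exists d; split=> //; exact: dS.
exists M, name; split=> //; last first.
  by move=> j; have [k Dk] := Ds (inr j); exists (s k).
split=> // N f NT fhom; split=> // m phi a fa.
have [g gP] := choice nameS; have {gP} ga : names name (g \o a) a.
  by move=> j; exact: gP.
apply/(sat_atP phi ga)/limitP.
have [k [nk|[fu _]]] := Ds (inl (Stmt (g \o a) phi)); last first.
  exact: forceF fu.
case: nk; exists N, (omap f \o name); split.
  split=> //; have [_ [c [nc cS]]] := nameP; exists (f \o c); split.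
    by move=> j; rewrite /= nc.
  by move=> chi /cS; exact: fhom.
rewrite sat_at_and; split; first exact: sat_at_homomorphism.
by exists (f \o a); split=> // j; rewrite /= ga.
Qed.

End GenericModel.

(** * Countable e.c. models realising and omitting types *)

Section Types.
Variables (L : signature) (T : theory L).
Hypothesis countL : countable_signature L.

Lemma countable_named (M : Type) (name : nat -> option M) :
  (forall m, exists i, name i = Some m) -> countable [set: M].
Proof.
move=> /choice[g gP]; apply/countable_injP; exists g => x y _ _ gxy.
by apply: Some_inj; rewrite -!gP gxy.
Qed.

(** This takes the place of a downward Löwenheim-Skolem theorem: the countable
    e.c. model is not a substructure of N, but realises the same formulas. *)
Lemma countable_realisation n (Sigma : set (formula L 'I_n)) (N : structure L)
    (c : 'I_n -> N) :
  model T N -> Sigma `<=` tp c ->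
  exists (M : structure L) (a : 'I_n -> M),
    [/\ ec_model T M, countable [set: M] & Sigma `<=` tp a].
Proof.
move=> NT cS.
have [|||M [e [Mec [_ [a [_ aS]]] eS _]]] := @generic_model L T countL n Sigma
    void (fun _ => 0) (fun _ _ => True).
- by case.
- by case.
- by exists N, c.
by exists M, a; split=> //; exact: countable_named eS.
Qed.

Lemma countable_ec_model : consistent T ->
  exists M : structure L, ec_model T M /\ countable [set: M].
Proof.
move=> [N NT]; have c0 : 'I_0 -> N by case.
have [M [_ [Mec Mc _]]] := @countable_realisation 0 set0 N c0 NT (@sub0set _ _).
by exists M.
Qed.

Lemma countable_type_realisation n (p : set (formula L 'I_n)) :
  is_type T p -> exists (M : structure L) (a : 'I_n -> M),
    [/\ ec_model T M, countable [set: M] & p = tp a].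
Proof.
move=> [N [c [Nec pE]]]; rewrite pE.
have [M [a [Mec Mc ca]]] :=
  countable_realisation (proj1 Nec) (fun phi (h : tp c phi) => h).
exists M, a; split=> //.
exact: ec_type_maximal Nec (proj1 Mec) ca.
Qed.

(** Omitting types. A condition never isolates an unsupported type p: either
    what it says about given names lies outside p already, or it is
    consistent with some formula refuting a member of p. *)
Lemma omitting_types n (p : set (formula L 'I_n)) :
  consistent T -> is_type T p -> ~ supported T p ->
  exists M : structure L,
    [/\ ec_model T M, countable [set: M] & forall a : 'I_n -> M, p <> tp a].
Proof.
move=> [N0 N0T] [K [d [Kec pE]]] nsupp.
have pointed (N : structure L) (e : nat -> option N) :
    model T N -> pointed_model T (set0 : set (formula L 'I_0)) e.
  move=> NT; split=> //; have c : 'I_0 -> N by case.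
  by exists c; split=> // -[].
have code_inj : injective
    (fun g : 'I_n -> nat => pickle [seq g i | i <- enum 'I_n]).
  by move=> g h /(pcan_inj pickleK)/map_enum_inj/funext.
pose cond := condition T (set0 : set (formula L 'I_0)).
pose D g v := ~ cond (stmt_and v (Stmt g (Top L 'I_n))) \/
  exists psi, ~ p psi /\ forces T (set0 : set (formula L 'I_0)) v (Stmt g psi).
have [||M [e [Mec eM eS eD]]] :=
    @generic_model L T countL 0 set0 ('I_n -> nat) _ D code_inj.
- move=> g u ucond.
  have [vcond|ncond] := pselect (cond (stmt_and u (Stmt g (Top L 'I_n))));
    last by exists u; split=> //; left.
  have [psi0 psi0P] := stmt_projection u g.
  have [ppsi|npsi] := pselect (p psi0); last first.
    exists (stmt_and u (Stmt g (Top L 'I_n))); split=> //.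
      by move=> N e _ /sat_at_and[].
    right; exists psi0; split=> // N e _ /sat_at_and[eu [c [/= ec _]]].
    by exists c; split=> //; apply/psi0P; exists e.
  have [chi [pchi nent]] : exists chi, p chi /\
      ~ entails (ec_theory T) (HInductive psi0 chi).
    apply: contrapT => nchi; apply: nsupp; exists psi0; split=> // chi pchi.
    by apply: contrapT => nent; apply: nchi; exists chi.
  have [N [b [Nec bpsi nbchi]]] : exists (N : structure L) (b : 'I_n -> N),
      [/\ ec_model T N, sat b psi0 & ~ sat b chi].
    apply: contrapT => nN; apply: nent; apply/ec_theory_entails => N Nec b bpsi.
    by apply: contrapT => nbchi; apply: nN; exists N, b.
  have [psi [bpsi' psiN]] := ec_refutation Nec nbchi.
  exists (stmt_and u (Stmt g psi)); split.
  + have [e [gb eu]] := (psi0P N b).1 bpsi.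
    exists N, e; split; first by apply: pointed; have [] := Nec.
    by apply/sat_at_and; split=> //; exists b.
  + by move=> N' e _ /sat_at_and[].
  + right; exists psi; split; last by move=> N' e _ /sat_at_and[].
    rewrite pE => dpsi; apply: (psiN K d (proj1 Kec) dpsi).
    by rewrite pE in pchi.
- exists N0; have c0 : 'I_0 -> N0 by case.
  by exists c0; split.
exists M; split=> //; first exact: countable_named eS.
move=> a pa; have [g gP] := choice eS.
have ga : names e (g \o a) a by move=> j; exact: gP.
have [v [[nv|[psi [npsi vpsi]]] ev]] := eD (g \o a).
  by apply: nv; exists M, e; split=> //; apply/sat_at_and; split=> //; exists a.
by apply: npsi; rewrite pa; apply/(sat_atP psi ga)/vpsi.
Qed.

(** * Back and forth *)

Section BackAndForth.
Hypothesis jepT : JEP T.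

(** By joint embedding all e.c. models satisfy the same formulas without free
    variables. *)
Lemma ec_sentence_transfer (M N : structure L) (a : 'I_0 -> M)
    (b : 'I_0 -> N) phi :
  ec_model T M -> ec_model T N -> sat a phi -> sat b phi.
Proof.
move=> Mec Nec pa; have [K [f [g [KT fhom ghom]]]] := jepT Mec Nec.
have [_ gimm] := Nec.2 K g KT ghom; apply: gimm.
have := fhom _ _ _ pa; congr (sat _ phi).
by apply: funext => -[].
Qed.

Hypothesis all_supported : forall n (p : set (formula L 'I_n)),
  is_type T p -> supported T p.

(** The formula that supports the type of (a, x), once x is quantified, belongs
    to tp(a), and hence to tp(b). *)
Lemma tp_extend (M N : structure L) n (a : 'I_n -> M) (b : 'I_n -> N) x :
  ec_model T M -> ec_model T N -> tp a = tp b ->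
  exists y, tp (cons_args x a) = tp (cons_args y b).
Proof.
move=> Mec Nec ab.
have [|phi [pphi phiP]] := @all_supported _ (tp (cons_args x a)).
  by exists M, (cons_args x a).
pose psi : formula L 'I_n := Ex (rename phi (unlift ord0)).
have : tp a psi by exists x; rewrite sat_rename; exact: pphi.
rewrite ab /tp /= => -[y]; rewrite sat_rename => yphi.
exists y; apply: (ec_type_maximal Mec (proj1 Nec)).
by move=> chi /phiP/ec_theory_entails/(_ N Nec); apply.
Qed.

Record matching (M N : Type) := Matching {
  matched : nat; left_tuple : 'I_matched -> M; right_tuple : 'I_matched -> N }.
Arguments left_tuple {M N} p i : rename.
Arguments right_tuple {M N} p i : rename.

Definition matches (M N : Type) (p : matching M N) x y :=
  exists i, left_tuple p i = x /\ right_tuple p i = y.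

(** The sets A and B are those that the matching must exhaust: with B empty
    this is an embedding, with both full an isomorphism. *)
Lemma back_and_forth (M N : structure L) (A : set M) (B : set N) :
  ec_model T M -> ec_model T N -> countable A -> countable B ->
  exists R : M -> N -> Prop,
    [/\ forall n (a : 'I_n -> M) (b : 'I_n -> N),
          (forall i, R (a i) (b i)) -> tp a = tp b,
        forall x, A x -> exists y, R x y & forall y, B y -> exists x, R x y].
Proof.
move=> Mec Nec /countable_injP[cA cA_inj] /countable_injP[cB cB_inj].
have a0 : 'I_0 -> M by case.
have b0 : 'I_0 -> N by case.
pose ok (p : matching M N) := tp (left_tuple p) = tp (right_tuple p).
pose le (p q : matching M N) := forall x y, matches p x y -> matches q x y.
pose D (j : {x | A x} + {y | B y}) (p : matching M N) := match j with
  | inl x => exists y, matches p (sval x) y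
  | inr y => exists x, matches p x (sval y) end.
pose code (j : {x | A x} + {y | B y}) := pickle (match j with
  | inl x => inl (cA (sval x)) | inr y => inr (cB (sval y)) end : nat + nat).
have le_cons (p : matching M N) x y :
    le p (Matching (cons_args x (left_tuple p))
                   (cons_args y (right_tuple p))).
  by move=> u v [i [<- <-]]; exists (lift ord0 i); rewrite /= /cons_args liftK.
have matches_cons k (a : 'I_k -> M) (b : 'I_k -> N) x y :
    matches (Matching (cons_args x a) (cons_args y b)) x y.
  by exists ord0; rewrite /= /cons_args unlift_none.
have [|||||s [_ oks les Ds]] :=
  @generic_sequence _ _ ok le D code (Matching a0 b0).
- move=> [[x Ax]|[y By]] [[x' Ax']|[y' By']] /(pcan_inj pickleK) [] // /=.
    by move=> /cA_inj xx; congr inl; apply: eq_exist; apply: xx; rewrite inE.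
  by move=> /cB_inj xx; congr inr; apply: eq_exist; apply: xx; rewrite inE.
- by move=> p x y.
- by move=> p q r pq qr x y /pq/qr.
- move=> [[x Ax]|[y By]] p okp.
    have [y xy] := tp_extend x Mec Nec okp.
    by exists (Matching (cons_args x (left_tuple p))
      (cons_args y (right_tuple p))); split=> //; exists y.
  have [x xy] := tp_extend y Nec Mec (esym okp).
  by exists (Matching (cons_args x (left_tuple p))
    (cons_args y (right_tuple p))); split=> //; exists x.
- by apply/seteqP; split=> phi; exact: ec_sentence_transfer.
exists (fun x y => exists k, matches (s k) x y); split.
- move=> n a b /choice[k kP].
  have common i : exists j, left_tuple (s (\max_i k i)) j = a i /\
      right_tuple (s (\max_i k i)) j = b i.
    by apply: les (kP i); apply: leq_bigmax.
  have [j jP] := choice common.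
  have -> : a = left_tuple (s (\max_i k i)) \o j.
    by apply: funext => i; have [] := jP i.
  have -> : b = right_tuple (s (\max_i k i)) \o j.
    by apply: funext => i; have [] := jP i.
  have /seteqP[lr rl] := oks (\max_i k i).
  apply/seteqP; split=> phi; rewrite /tp /= => h; rewrite -sat_rename.
    by apply: lr; rewrite /tp /= sat_rename.
  by apply: rl; rewrite /tp /= sat_rename.
- move=> x Ax; have [k [y xy]] := Ds (inl (exist _ x Ax)).
  by exists y, k.
- move=> y By; have [k [x xy]] := Ds (inr (exist _ y By)).
  by exists x, k.
Qed.

Lemma countable_embeds (M N : structure L) :
  ec_model T M -> ec_model T N -> countable [set: M] ->
  exists f : M -> N, homomorphism f.
Proof.
move=> Mec Nec Mc.
have [R [Rtp Rtot _]] := back_and_forth Mec Nec Mc (countable0 N).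
have [f fP] := choice (fun x => Rtot x I); exists f => n phi a.
have -> : sat a phi = tp a phi by [].
by rewrite (Rtp n a (f \o a)).
Qed.

Lemma countable_isomorphic (M N : structure L) :
  ec_model T M -> ec_model T N -> countable [set: M] -> countable [set: N] ->
  isomorphic M N.
Proof.
move=> Mec Nec Mc Nc.
have [R [Rtp Rtot Rsurj]] := back_and_forth Mec Nec Mc Nc.
have [f fP] := choice (fun x => Rtot x I).
have [g gP] := choice (fun y => Rsurj y I).
have Req x y x' y' : R x y -> R x' y' -> x = x' <-> y = y'.
  move=> xy xy'.
  pose pair (Z : Type) (z z' : Z) (i : 'I_2) := if i == ord0 then z else z'.
  have /seteqP[RL RR] : tp (pair M x x') = tp (pair N y y').
    by apply: Rtp => i; rewrite /pair; case: ifP.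
  by split; [exact: (RL (Equal (Var L ord0) (Var L ord_max)))
           | exact: (RR (Equal (Var L ord0) (Var L ord_max)))].
exists f, g; split.
- move=> n phi a; have -> : sat a phi = tp a phi by [].
  by rewrite (Rtp n a (f \o a)).
- move=> n phi a; have -> : sat a phi = tp a phi by [].
  by rewrite -(Rtp n (g \o a) a) // => i; exact: gP.
- by move=> x; apply/(Req _ _ _ _ (gP (f x)) (fP x)).
- by move=> y; apply/(Req _ _ _ _ (fP (g y)) (gP y)).
Qed.

End BackAndForth.
End Types.

(** * Saturation *)

Lemma finite_enumeration (X : Type) (A : set X) : finite_set A ->
  exists n (t : 'I_n -> A) (t' : A -> 'I_n), cancel t t' /\ cancel t' t.
Proof.
move=> /finite_setP[n]; rewrite card_eq_sym => /card_bijP[f [g fK gK]].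
have mem (i : 'I_n) : (i : nat) \in `I_n by rewrite inE /=.
have lt (x : `I_n) : sval x < n by have := svalP x; rewrite inE.
exists n, (fun i : 'I_n => f (exist (fun x => x \in `I_n) (val i) (mem i))).
exists (fun x => Ordinal (lt (g x))).
split=> [i|x]; first by apply: val_inj; rewrite /= fK.
by rewrite -[RHS]gK; congr f; apply: val_inj.
Qed.

Lemma finite_type_enumeration (X : Type) : finite_set [set: X] ->
  exists n (t : 'I_n -> X) (t' : X -> 'I_n), cancel t t' /\ cancel t' t.
Proof.
move=> /finite_enumeration[n [t [t' [tK t'K]]]].
have mem (x : X) : x \in [set: X] by rewrite inE.
exists n, (fun i => sval (t i)).
exists (fun x => t' (exist (fun x => x \in setT) x (mem x))).
split=> [i|x]; last by rewrite t'K.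
by rewrite -[RHS]tK; congr t'; apply: val_inj.
Qed.

Lemma finite_card_lt (X K : Type) (A : set X) :
  finite_set A -> infinite_set [set: K] -> card_lt A [set: K].
Proof.
move=> fA iK; split=> [|KA].
  apply: card_le_trans (finite_set_countable fA) _; exact/infiniteP.
exact/iK/(card_le_finite KA).
Qed.

Section Saturation.
Variables (L : signature) (T : theory L).

Lemma finite_renamed_enumeration n (q : set (formula L 'I_n)) (V : Type)
    (r : set (formula L V)) (h : 'I_n -> V) :
  finite_set r -> r `<=` [set rename phi h | phi in q] ->
  exists k (chi : 'I_k -> formula L 'I_n), (forall i, q (chi i)) /\
    forall phi, r phi -> exists i, phi = rename (chi i) h.
Proof.
move=> /finite_enumeration[k [t [t' [tK t'K]]]] rq.
have chiP i : exists chi, q chi /\ sval (t i) = rename chi h.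
  have [|chi qchi <-] := rq (sval (t i)); last by exists chi.
  by have := svalP (t i); rewrite inE.
have [chi {}chiP] := choice chiP; exists k, chi.
split=> [i|phi rphi]; first by have [] := chiP i.
have mphi : phi \in r by rewrite inE.
pose x := exist _ phi mphi : r; exists (t' x).
by have [_ <-] := chiP (t' x); rewrite t'K.
Qed.

(** By joint embedding a type of T is finitely satisfiable in every e.c. model;
    a finite model is compact, and so needs no saturation to realise it. *)
Lemma saturated_realises_types (M : structure L) :
  JEP T -> ec_model T M ->
  (finite_set [set: M] \/
   exists K : Type, infinite_set [set: K] /\ saturated_in K M) ->
  forall n (p : set (formula L 'I_n)), is_type T p ->
  exists a : 'I_n -> M, p = tp a.
Proof.
move=> jepT Mec Msat n p [N [d [Nec ->]]].
suff [a da] : exists a : 'I_n -> M, tp d `<=` tp a.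
  by exists a; exact: ec_type_maximal Nec (proj1 Mec) da.
have approx phi : tp d phi -> exists a : 'I_n -> M, sat a phi.
  move=> dphi; have [psi psiP] := exists_block (rename phi (@inl _ 'I_0)).
  have b0 : 'I_0 -> N by case.
  have a0 : 'I_0 -> M by case.
  have : sat b0 psi by apply/psiP; exists d; rewrite sat_rename.
  move=> /(ec_sentence_transfer jepT a0 Nec Mec)/psiP[a].
  by rewrite sat_rename => pa; exists a.
case: Msat => [/finite_type_enumeration[k [t [t' [tK t'K]]]]|[K [infK satK]]].
  apply: contrapT => noa.
  have [|chi chiP] := @choice {ffun 'I_n -> 'I_k} (formula L 'I_n)
      (fun f chi => sat d chi /\ ~ sat (t \o f) chi).
    move=> f; apply: contrapT => nochi; apply: noa; exists (t \o f) => chi dchi.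
    by apply: contrapT => nchi; apply: nochi; exists chi.
  have [|a /sat_big_and aP] := approx (big_and chi).
    by apply/sat_big_and => f; have [] := chiP f.
  have := aP [ffun i => t' (a i)]; have [_] := chiP [ffun i => t' (a i)].
  by congr (~ sat _ _); apply: funext => i; rewrite /= ffunE t'K.
pose r := [set rename phi (@inl 'I_n (set0 : set M)) | phi in tp d].
have [||| b bP] := satK 'I_n set0 r.
- apply: finite_card_lt => //; exact: finite_finset.
- by apply: finite_card_lt.
- move=> q qr finq; have [k [chi [dchi qchi]]] := finite_renamed_enumeration finq qr.
  have [|a /sat_big_and aP] := approx (big_and chi).
    by apply/sat_big_and.
  by exists a => phi /qchi[i ->]; rewrite sat_rename; exact: aP.
exists b => phi dphi; have := bP (rename phi inl); rewrite sat_rename.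
by apply; exists phi.
Qed.

Lemma omega_saturated_saturated (M : structure L) :
  countable [set: M] -> omega_saturated M -> saturated M.
Proof.
move=> Mc Msat V A p VM AM; apply: Msat.
  split; first exact: card_le_trans VM.1 Mc.
  by move=> NV; apply: VM.2; exact: card_le_trans Mc NV.
split; first exact: card_le_trans AM.1 Mc.
by move=> NA; apply: AM.2; exact: card_le_trans Mc NA.
Qed.

(** By compactness, a finitely satisfiable partial type is contained in the type
    of a finite tuple that extends a copy of the parameters. A formula supporting
    the type of this tuple has, by maximality of the type of the parameters, a
    solution over the parameters themselves, and it entails the partial type. *)
Lemma supported_omega_saturated (M : structure L) :
  countable_signature L ->
  (forall n (p : set (formula L 'I_n)), is_type T p -> supported T p) ->
  ec_model T M -> omega_saturated M.
Proof.
move=> countL all_supp Mec V A p.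
move=> [_ /finite_setPn finV] [_ /finite_setPn finA] psat.
have [m [tv [tv' [tvK tv'K]]]] := finite_type_enumeration finV.
have [k [ta [ta' [taK ta'K]]]] := finite_enumeration finA.
pose W := (V + A)%type.
pose t (i : 'I_(m + k)) : W := match fintype.split i with
  | inl j => inl (tv j) | inr j => inr (ta j) end.
pose t' (w : W) : 'I_(m + k) := match w with
  | inl v => lshift k (tv' v) | inr a => rshift m (ta' a) end.
have t'K : cancel t' t.
  move=> [v|a]; rewrite /t /t' /=;
    case: split_ordP => j /eqP; rewrite ?eq_shift // => /eqP <-.
    by rewrite tv'K.
  by rewrite ta'K.
have tK : cancel t t'.
  by move=> i; rewrite /t /t' /=; case: split_ordP => j ->; rewrite ?tvK ?taK.
pose wp (b : V -> M) : W -> M := with_params b.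
pose Gamma := [set u : stmt L W | exists q, [/\ q `<=` p, finite_set q &
  forall b, realises b q -> sat_at (@Some M \o wp b) u]].
have always u : (forall b, sat_at (@Some M \o wp b) u) -> Gamma u.
  by move=> hu; exists set0; split=> // b _; exact: hu.
have Gtop : Gamma (Stmt t (Top L _)).
  by apply: always => b; exists (wp b \o t).
have [|||N [e [NT eP]]] := @compactness L T W Gamma.
- by exists (Stmt t (Top L _)).
- move=> u v [q [qp qfin qu]] [q' [qp' qfin' qv]]; exists (q `|` q'); split.
  + by rewrite subUset.
  + by rewrite finite_setU.
  + move=> b bq; apply/sat_at_and; split.
      by apply: qu => phi qphi; apply: bq; left.
    by apply: qv => phi qphi; apply: bq; right.
- move=> u [q [qp qfin qu]]; have [b /qu bu] := psat q qp qfin.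
  by exists M, (@Some M \o wp b); split=> //; have [] := Mec.
have [c [tc _]] := eP _ Gtop.
pose Sigma := [set chi | Gamma (Stmt t chi)].
have cS : Sigma `<=` tp c by move=> chi /eP/(sat_atP chi tc).
have [K [d [Kec _ dS]]] := countable_realisation countL NT cS.
have [|phi [dphi phiP]] := all_supp _ (tp d); first by exists K, d.
pose a : 'I_k -> W := inr \o ta.
have [psi psiP] := stmt_projection (Stmt t phi) a.
have Mpsi : sat (fun i => sval (ta i)) psi.
  apply: contrapT => /(ec_refutation Mec)[psi' [Mpsi' psiN]].
  apply: (psiN K (d \o t' \o a) (proj1 Kec)).
    have : Sigma (rename psi' (t' \o a)).
      apply: always => b; exists (wp b \o t); split=> //=.
      rewrite sat_rename; congr (sat _ psi'): Mpsi'.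
      by apply: funext => i; rewrite -[RHS]/(wp b (t (t' (a i)))) t'K.
    by move=> /dS; rewrite /tp /= sat_rename.
  apply/psiP; exists (@Some K \o d \o t'); split=> //.
  by exists d; split=> // i; rewrite /= tK.
have [e' [ae [c' [te' c'phi]]]] := (psiP M _).1 Mpsi.
pose b v := c' (t' (inl v)).
have e'E w : e' w = Some (c' (t' w)) by rewrite -{1}[w]t'K; exact: te'.
have bE : with_params b = c' \o t' :> (W -> M).
  apply: funext => -[v|x] //; apply: Some_inj.
  by have := ae (ta' x); rewrite e'E /a /= ta'K.
exists b => chi pchi; rewrite bE -sat_rename.
have := phiP (rename chi t'); rewrite ec_theory_entails => /(_ _ M Mec c').
apply => //; apply: dS; exists [set chi]; split=> //.
- by move=> _ ->.
- move=> b' b'chi; exists (wp b' \o t); split=> //=; rewrite sat_rename.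
  have -> : (wp b' \o t) \o t' = with_params b'.
    by apply: funext => w; rewrite /= t'K.
  exact: b'chi.
Qed.

End Saturation.

(** * The equivalences *)

Section Equivalences.
Variables (L : signature) (T : theory L).
Hypotheses (countL : countable_signature L) (consT : consistent T).

Lemma supported_of_countable_realisations n (p : set (formula L 'I_n)) :
  is_type T p ->
  (forall M : structure L, ec_model T M -> countable [set: M] ->
     exists a : 'I_n -> M, p = tp a) ->
  supported T p.
Proof.
move=> pT preal; apply: contrapT => /(omitting_types countL consT pT).
by move=> [M [Mec Mc nop]]; have [a /nop] := preal M Mec Mc.
Qed.

Lemma tp_homomorphism (M N : structure L) (f : M -> N) n (a : 'I_n -> M) :
  ec_model T M -> model T N -> homomorphism f -> tp a = tp (f \o a).
Proof.
move=> Mec NT fhom; apply: (ec_type_maximal Mec NT) => phi; exact: fhom.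
Qed.

Lemma categorical_types_supported :
  omega_categorical T ->
  forall n (p : set (formula L 'I_n)), is_type T p -> supported T p.
Proof.
move=> [M0 [M0ec _ M0iso]] n p pT.
apply: supported_of_countable_realisations => // N Nec Nc.
have [M [a [Mec Mc ->]]] := countable_type_realisation countL pT.
have [_ [f [_ fhom _ _]]] := M0iso M Mec Mc.
have [g [_ [ghom _ _ _]]] := M0iso N Nec Nc.
exists (g \o f \o a).
by rewrite (tp_homomorphism a Mec (proj1 M0ec) fhom)
  (tp_homomorphism _ M0ec (proj1 Nec) ghom).
Qed.

Lemma countable_atomic_types_supported :
  (forall M : structure L, ec_model T M -> countable [set: M] -> atomic T M) ->
  forall n (p : set (formula L 'I_n)), is_type T p -> supported T p.
Proof.
move=> atom n p pT.
have [M [a [Mec Mc ->]]] := countable_type_realisation countL pT.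
exact: atom.
Qed.

Hypothesis jepT : JEP T.

Lemma omega_saturated_types_supported :
  (forall M : structure L, ec_model T M -> omega_saturated M) ->
  forall n (p : set (formula L 'I_n)), is_type T p -> supported T p.
Proof.
move=> satT n p pT; apply: supported_of_countable_realisations => // M Mec _.
apply: (saturated_realises_types jepT Mec) pT; right; exists nat.
by split; [exact: infinite_nat | exact: satT].
Qed.

Lemma saturated_prime_types_supported (M : structure L) :
  ec_model T M -> saturated M -> prime_model T M ->
  forall n (p : set (formula L 'I_n)), is_type T p -> supported T p.
Proof.
move=> Mec Msat Mprime n p pT.
apply: supported_of_countable_realisations => // N Nec _.
have [|a ->] := saturated_realises_types jepT Mec _ pT.
  by have [|infM] := pselect (finite_set [set: M]); [left|right; exists M].
have [f fhom] := Mprime N Nec; exists (f \o a).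
exact: tp_homomorphism Mec (proj1 Nec) fhom.
Qed.

End Equivalences.

Theorem theorem5p8 (L : signature) (T : theory L) :
  countable_signature L -> consistent T -> JEP T ->
  [<-> omega_categorical T;
       forall (n : nat) (p : set (formula L 'I_n)),
         is_type T p -> supported T p;
       forall M : structure L, ec_model T M -> atomic T M;
       forall M : structure L, ec_model T M -> countable [set: M] ->
         atomic T M;
       forall M : structure L, ec_model T M -> omega_saturated M;
       exists M : structure L,
         [/\ ec_model T M, saturated M & prime_model T M] ].
Proof.
move=> countL consT jepT.
have [M [Mec Mc]] := countable_ec_model countL consT.
tfae.
- exact: categorical_types_supported.
- by move=> supp N Nec n a; apply: supp; exists N, a.
- by move=> atom N Nec _; exact: atom.
- move=> /(countable_atomic_types_supported countL) supp N Nec.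
  exact: supported_omega_saturated countL supp Nec.
- move=> satT; exists M; split=> //.
    exact/omega_saturated_saturated/satT.
  move=> N Nec; apply: countable_embeds Mec Nec Mc => //.
  exact: omega_saturated_types_supported.
- move=> [N [Nec Nsat Nprime]]; exists M; split=> // N' N'ec N'c.
  apply: countable_isomorphic Mec N'ec Mc N'c => //.
  exact: saturated_prime_types_supported Nec Nsat Nprime.
Qed.
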